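(* Let $A,B$ be finite-dimensional quantum systems, let $\mathcal{E}_{B|A}$ be a quantum operation (CPTP map) from $A$ to $B$, let $\epsilon\in[0,1]$, and let $\Omega$ be any class of bipartite operations containing the class $\mathrm{L}$ of local operations with shared randomness. For every state $\rho_A$ of $A$, $$\log M_{\epsilon}(\mathcal{E}_{B|A},\rho_A)\;\le\; I^{\Omega}_{\epsilon}(\mathcal{E}_{B|A},\rho_A),$$ and consequently $$\log M_{\epsilon}(\mathcal{E}_{B|A})\;\le\;\max_{\rho_A\in\mathrm{states}(A)} I^{\Omega}_{\epsilon}(\mathcal{E}_{B|A},\rho_A).$$ Here $M_\epsilon$ is the maximal size of unassisted codes and $I^{\Omega}_\epsilon$ is the restricted hypothesis-testing quantity, both defined in the context.
   Context: All systems are finite-dimensional, each with a fixed orthonormal (''classical'') basis $\{|i\rangle\}$; the classical basis of a composite system is the product basis. $\mathrm{states}(Q)$ is the set of density operators on $\mathcal{H}_Q$; an operation is a CPTP map. Tensor products and identity maps on other systems are omitted. Classes of bipartite operations. A class $\Omega$ assigns to all systems $A,B,A',B'$ a set $\mathrm{ops}^\Omega(A{:}B\to A'{:}B')$ of operations from $AB$ to $A'B'$. $\mathrm{L}$: operations of the form $\sum_r p_r\,\mathcal{F}^{(r)}_{A'|A}\otimes\mathcal{D}^{(r)}_{B'|B}$ with $\mathcal{F}^{(r)},\mathcal{D}^{(r)}$ operations and $(p_r)$ a probability distribution. $\Omega$ contains $\mathrm L$ if $\mathrm{ops}^{\mathrm L}\subseteq\mathrm{ops}^{\Omega}$ for all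 systems. $\mathrm{mops}^\Omega$ is the subset of measurement operations in $\mathrm{ops}^\Omega$: those whose output is always diagonal in the classical basis of $A'B'$. Hypothesis testing. For probability distributions $P^{(0)},P^{(1)}$ on a finite set, $\beta_\epsilon(P^{(0)}\|P^{(1)}):=\min\{\sum_r P^{(1)}(r)T(r): 0\le T(r)\le1,\ \sum_rP^{(0)}(r)T(r)\ge1-\epsilon\}$; diagonal states are identified with distributions. For states of $AB$, $\beta^\Omega_\epsilon(\tau^{(0)}_{AB}\|\tau^{(1)}_{AB}):=\inf\beta_\epsilon(\mathcal{M}\tau^{(0)}_{AB}\|\mathcal{M}\tau^{(1)}_{AB})$, the infimum being over all $\mathcal{M}\in\mathrm{mops}^\Omega(A{:}B\to A'{:}B')$ with $A',B'$ arbitrary. $D^\Omega_\epsilon:=-\log\beta^\Omega_\epsilon$ (with $-\log0=+\infty$). Canonical purification. For a state $\rho_A$, let $\tilde A$ be a copy of $A$, $\Phi_{\tilde A A}:=\sum_{i,j}|i\rangle_{\tilde A}|i\rangle_A\langle j|_{\tilde A}\langle j|_A$, $\rho_{\tilde A A}:=\rho_A^{1/2}\Phi_{\tilde AA}\rho_A^{1/2}$, $\rho_{\tilde A}:=\mathrm{Tr}_A\,\rho_{\tilde AA}$. Define $$I^{\Omega}_\epsilon(\mathcal{E}_{B|A},\rho_A):=\min_{\sigma_B\in\mathrm{states}(B)}D^{\Omega}_\epsilon(\mathcal{E}_{B|A}\rho_{\tilde AA}\,\|\,\rho_{\tilde A}\otimes\sigma_B),$$ with respect to the bipartition $\tilde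 A{:}B$. Maxima over states are understood as suprema if not attained. Codes. An unassisted code of size $M$ consists of states $\rho(w)_A$, $w\in\{1,\dots,M\}$, and a decoding POVM $\{D(\hat w)_B\}_{\hat w=1}^M$ on $B$. When used with $\mathcal{E}_{B|A}$, $\Pr(\hat W=\hat w|W=w)=\mathrm{Tr}\,D(\hat w)_B\,\mathcal{E}_{B|A}\rho(w)_A$. It is an $(M,\epsilon,\rho_A)$ code for $\mathcal{E}$ if, for equiprobable messages, $\Pr(\hat W\neq W)\le\epsilon$ and $\frac1M\sum_w\rho(w)_A=\rho_A$. $M_\epsilon(\mathcal{E}_{B|A},\rho_A)$ is the largest $M$ for which there is an $(M,\epsilon,\rho_A)$ unassisted code for $\mathcal{E}$ (understood as a supremum, possibly $+\infty$), and $M_\epsilon(\mathcal{E}_{B|A})$ is the largest $M$ for which such a code exists for some $\rho_A$. *)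

(* Defs.v *)
From HB Require Import structures.
From mathcomp Require Import all_boot all_order all_algebra.
From mathcomp Require Import spectral sesquilinear complex mxtens.
From mathcomp Require Import all_classical all_reals all_analysis.
Set Implicit Arguments.
Unset Strict Implicit.
Unset Printing Implicit Defensive.
Import Order.TTheory GRing.Theory Num.Theory.
Local Open Scope classical_set_scope.
Local Open Scope ring_scope.
Local Open Scope complex_scope.
Local Open Scope sesquilinear_scope.

(* A system is given by its dimension n; its operators are
   'M[R[i]]_n, written in the classical basis. A composite of systems of
   dimensions m and n has dimension m * n, and [mxtens_index (i, k)] is the
   index of the product basis vector |i>|k>. Dimension 0 is not excluded, but a
   system of dimension 0 has no state, and no operation maps a system of nonzero
   dimension to it. *)

Section Operators.
Variable R : realType.
Local Notation C := R[i].

(* [0 <= z] on R[i] means that z is real and nonnegative, so a [psd] matrix is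
   Hermitian. *)
Definition psd n (A : 'M[C]_n) : Prop :=
  forall v : 'cV[C]_n, 0 <= (v ^t* *m A *m v) 0 0.

Definition states n : set 'M[C]_n := [set rho | psd rho /\ \tr rho = 1].

(* The functional calculus of the square root: the value at A is the positive
   semidefinite square root of A only if A is positive semidefinite. *)
Definition sqrtmx n (A : 'M[C]_n) : 'M[C]_n :=
  invmx (spectralmx A) *m diag_mx (map_mx sqrtC (spectral_diag A))
    *m spectralmx A.

(* Trace over the second factor. *)
Definition ptrace2 m n (X : 'M[C]_(m * n)) : 'M[C]_m :=
  \matrix_(i, j) \sum_(k < n) X (mxtens_index (i, k)) (mxtens_index (j, k)).

(* The tensor product of two linear maps, given by its values on the matrix
   units |i><j| (x) |k><l|. *)
Definition tensop m n m' n' (F : 'M[C]_m -> 'M[C]_m') (D : 'M[C]_n -> 'M[C]_n')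
    (X : 'M[C]_(m * n)) : 'M[C]_(m' * n') :=
  \sum_(i < m) \sum_(j < m) \sum_(k < n) \sum_(l < n)
    X (mxtens_index (i, k)) (mxtens_index (j, l)) *:
      (F (delta_mx i j) *t D (delta_mx k l)).

Definition completely_positive m n (F : 'M[C]_m -> 'M[C]_n) : Prop :=
  forall (k : nat) (X : 'M[C]_(k * m)),
    psd X -> psd (tensop (@id 'M[C]_k) F X).

Definition trace_preserving m n (F : 'M[C]_m -> 'M[C]_n) : Prop :=
  forall X, \tr (F X) = \tr X.

Definition operation m n (F : 'M[C]_m -> 'M[C]_n) : Prop :=
  [/\ linear F, completely_positive F & trace_preserving F].

(* |Phi> is the unnormalized vector sum_i |i>|i>. *)
Definition max_entangled n : 'M[C]_(n * n) :=
  \sum_(i < n) \sum_(j < n) (delta_mx i j *t delta_mx i j).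

(* The first factor is the copy of the system, the second the system itself. *)
Definition canonical_purification n (rho : 'M[C]_n) : 'M[C]_(n * n) :=
  (1%:M *t sqrtmx rho) *m max_entangled n *m (1%:M *t sqrtmx rho).

End Operators.

Section BipartiteClasses.
Variable R : realType.
Local Notation C := R[i].

Record bipartite_class := BipartiteClass {
  ops : forall a b a' b' : nat, set ('M[C]_(a * b) -> 'M[C]_(a' * b'));
  ops_operation : forall a b a' b' F, @ops a b a' b' F -> operation F
}.

Definition local_ops a b a' b' : set ('M[C]_(a * b) -> 'M[C]_(a' * b')) :=
  [set G | exists (N : nat) (p : 'I_N -> R)
      (F : 'I_N -> 'M[C]_a -> 'M[C]_a') (D : 'I_N -> 'M[C]_b -> 'M[C]_b'),
    [/\ forall r, 0 <= p r, \sum_r p r = 1,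
        forall r, operation (F r), forall r, operation (D r)
      & forall X, G X = \sum_r (p r)%:C *: tensop (F r) (D r) X]].

Definition contains_local (Omega : bipartite_class) : Prop :=
  forall a b a' b', @local_ops a b a' b' `<=` @ops Omega a b a' b'.

Definition mops (Omega : bipartite_class) a b a' b' :
    set ('M[C]_(a * b) -> 'M[C]_(a' * b')) :=
  [set M | ops Omega M /\
    forall tau, states tau -> is_diag_mx (M tau)].

End BipartiteClasses.

Section HypothesisTesting.
Variable R : realType.
Local Notation C := R[i].
Local Open Scope ereal_scope.

Definition beta (eps : R) (I : finType) (P0 P1 : I -> R) : \bar R :=
  ereal_inf [set (\sum_r P1 r * T r)%R%:E | T in [set T : I -> R |
    (forall r, 0 <= T r <= 1)%R /\ (1 - eps <= \sum_r P0 r * T r)%R]].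

(* The distribution identified with a diagonal state. *)
Definition diag_distr n (tau : 'M[C]_n) (r : 'I_n) : R := complex.Re (tau r r).

Definition beta_class (Omega : bipartite_class R) (eps : R) a b
    (tau0 tau1 : 'M[C]_(a * b)) : \bar R :=
  ereal_inf [set x | exists (a' b' : nat) (M : 'M[C]_(a * b) -> 'M[C]_(a' * b')),
    mops Omega M /\
    x = beta eps (diag_distr (M tau0)) (diag_distr (M tau1))].

(* [lne] is the natural logarithm on \bar R, with lne 0 = -oo and
   lne +oo = +oo; code sizes are measured with the same base. *)
Definition D_class (Omega : bipartite_class R) (eps : R) a b
    (tau0 tau1 : 'M[C]_(a * b)) : \bar R :=
  - lne (beta_class Omega eps tau0 tau1).

Definition I_class (Omega : bipartite_class R) (eps : R) a b
    (E : 'M[C]_a -> 'M[C]_b) (rho : 'M[C]_a) : \bar R :=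
  let psi := canonical_purification rho in
  ereal_inf [set D_class Omega eps (tensop (@id 'M[C]_a) E psi)
                   (ptrace2 psi *t sigma) | sigma in @states R b].

End HypothesisTesting.

Section Codes.
Variable R : realType.
Local Notation C := R[i].

Record unassisted_code (M a b : nat) := UnassistedCode {
  encoding : 'I_M -> 'M[C]_a;
  decoding : 'I_M -> 'M[C]_b;
  encoding_state : forall w, states (encoding w);
  decoding_psd : forall w, psd (decoding w);
  decoding_sum : \sum_w decoding w = 1%:M
}.

Definition code_prob M a b (c : unassisted_code M a b)
    (E : 'M[C]_a -> 'M[C]_b) (w w' : 'I_M) : R :=
  complex.Re (\tr (decoding c w' *m E (encoding c w))).

Definition error_prob M a b (c : unassisted_code M a b)
    (E : 'M[C]_a -> 'M[C]_b) : R :=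
  M%:R^-1 * \sum_(w < M) \sum_(w' < M | w' != w) code_prob c E w w'.

Definition is_code M (eps : R) a b (rho : 'M[C]_a) (E : 'M[C]_a -> 'M[C]_b)
    (c : unassisted_code M a b) : Prop :=
  [/\ (0 < M)%N, error_prob c E <= eps
    & M%:R^-1 *: (\sum_w encoding c w) = rho].

Definition max_size_at (eps : R) a b (E : 'M[C]_a -> 'M[C]_b)
    (rho : 'M[C]_a) : \bar R :=
  ereal_sup [set (M%:R)%:E | M in [set M : nat |
    exists c : unassisted_code M a b, is_code eps rho E c]].

Definition max_size (eps : R) a b (E : 'M[C]_a -> 'M[C]_b) : \bar R :=
  ereal_sup [set (M%:R)%:E | M in [set M : nat |
    exists (rho : 'M[C]_a) (c : unassisted_code M a b),
      states rho /\ is_code eps rho E c]].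

End Codes.

(* Main.v *)
(** Let [S] be the square root of [rho] and [T] its pseudo-inverse. Measuring
    the copy of the system with the POVM [Q w], where [(Q w)^T] is
    [M^-1 (T rho(w) T + (1 - S T))], steers the other half of the canonical
    purification of [rho] to the codeword state [rho(w)] with probability [1/M].
    Together with the decoder on the output this is a local measurement that
    simulates the code on equiprobable messages. The test that accepts when the
    two outcomes agree passes with probability at least [1 - eps] on the output
    of the channel, and with probability exactly [1/M] on a product state,
    because the first outcome is then uniform and independent of the second. *)
From HB Require Import structures.
Require Import Defs.
From mathcomp Require Import all_boot all_order all_algebra.
From mathcomp Require Import spectral sesquilinear complex mxtens.
From mathcomp Require Import all_classical all_reals all_analysis.
Set Implicit Arguments.
Unset Strict Implicit.
Unset Printing Implicit Defensive.
Import Order.TTheory GRing.Theory Num.Theory.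
Local Open Scope classical_set_scope.
Local Open Scope ring_scope.
Local Open Scope complex_scope.
Local Open Scope sesquilinear_scope.

(** * Conjugate transposes *)

Section Adjoint.
Variable C : numClosedFieldType.

Lemma adjmxM m n p (A : 'M[C]_(m, n)) (B : 'M[C]_(n, p)) :
  (A *m B)^t* = B^t* *m A^t*.
Proof. by rewrite trmx_mul map_mxM. Qed.

Lemma adjmxD m n (A B : 'M[C]_(m, n)) : (A + B)^t* = A^t* + B^t*.
Proof. by rewrite linearD map_mxD. Qed.

Lemma adjmxB m n (A B : 'M[C]_(m, n)) : (A - B)^t* = A^t* - B^t*.
Proof. by rewrite linearB map_mxB. Qed.

Lemma adjmx1 n : (1%:M : 'M[C]_n)^t* = 1%:M.
Proof. by rewrite trmx1 map_mx1. Qed.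

Lemma adjmx_delta m n i j : (delta_mx i j : 'M[C]_(m, n))^t* = delta_mx j i.
Proof. by rewrite trmx_delta map_delta_mx. Qed.

(** Each diagonal entry of the sum is a sum of squared moduli of entries of the [B w], so all of
    these vanish. *)
Lemma sum_adjmx_mul_eq0 k m n (B : 'I_k -> 'M[C]_(m, n)) :
  \sum_w (B w)^t* *m B w = 0 -> forall w, B w = 0.
Proof.
move=> B0 w; apply/matrixP => i j; rewrite mxE.
have : \sum_w \sum_i `|B w i j| ^+ 2 = 0.
  transitivity ((\sum_w (B w)^t* *m B w) j j); last by rewrite B0 mxE.
  rewrite summxE; apply: eq_bigr => w' _; rewrite mxE.
  by apply: eq_bigr => i' _; rewrite !mxE mulrC normCK.
move/psumr_eq0P =>
  /(_ (fun _ _ => sumr_ge0 _ (fun _ _ => exprn_ge0 _ (normr_ge0 _)))).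
move/(_ w isT)/psumr_eq0P => /(_ (fun _ _ => exprn_ge0 _ (normr_ge0 _)) i isT).
by move/eqP; rewrite sqrf_eq0 normr_eq0 => /eqP.
Qed.

End Adjoint.

(** * Positive semidefinite matrices, their functional calculus, and steering *)

Section PositiveSemidefinite.
Variable R : realType.
Local Notation C := R[i].

Lemma psd_congr m n (A : 'M[C]_m) (K : 'M[C]_(n, m)) :
  psd A -> psd (K *m A *m K^t*).
Proof.
by move=> A0 v; have := A0 (K^t* *m v); rewrite adjmxM trmxCK !mulmxA.
Qed.

Lemma psd_sum (I : finType) n (A : I -> 'M[C]_n) :
  (forall i, psd (A i)) -> psd (\sum_i A i).
Proof.
move=> A0 v; rewrite mulmx_sumr mulmx_suml summxE.
by apply: sumr_ge0 => i _; apply: A0.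
Qed.

Lemma psdD n (A B : 'M[C]_n) : psd A -> psd B -> psd (A + B).
Proof. by move=> A0 B0 v; rewrite mulmxDr mulmxDl mxE addr_ge0. Qed.

Lemma psdZ n (c : C) (A : 'M[C]_n) : 0 <= c -> psd A -> psd (c *: A).
Proof. by move=> c0 A0 v; rewrite -scalemxAr -scalemxAl mxE mulr_ge0. Qed.

Lemma psd_adj_mul m n (K : 'M[C]_(m, n)) : psd (K^t* *m K).
Proof.
move=> v; rewrite mulmxA -adjmxM -mulmxA mxE sumr_ge0 // => i _.
by rewrite !mxE mulrC mul_conjC_ge0.
Qed.

Lemma psd_tr n (A : 'M[C]_n) : psd A -> psd A^T.
Proof.
move=> A0 v; pose u := map_mx Num.conj v; have := A0 u.
suff -> : v^t* *m A^T *m v = (u^t* *m A *m u)^T.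
  by rewrite [X in _ -> 0 <= X]mxE.
rewrite /u !trmx_mul -?map_trmx -?map_mx_comp (map_mx_id (@conjCK _)).
by rewrite trmxK mulmxA.
Qed.

(** The quadratic form of [A] is real, so that of [A^t* - A] vanishes on every vector; by complex
    polarization the matrix itself vanishes. *)
Lemma psd_adj n (A : 'M[C]_n) : psd A -> A^t* = A.
Proof.
move=> A0; have B0 (v : 'cV[C]_n) : (v^t* *m (A^t* - A) *m v) 0 0 = 0.
  have /CrealP vr : (v^t* *m A *m v) 0 0 \is Num.real by rewrite ger0_real.
  rewrite mulmxBr mulmxBl mxE [X in _ + X]mxE.
  have -> : v^t* *m A^t* *m v = (v^t* *m A *m v)^t*.
    by rewrite !adjmxM trmxCK mulmxA.
  by rewrite [X in X - _]mxE [X in Num.conj X]mxE vr subrr.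
apply/eqP; rewrite -subr_eq0; apply/eqP; move: (A^t* - A) B0 => B B0.
have Bij i j (x : C) :
    B i i + x * B i j + (x^* * B j i + x * x^* * B j j) = 0.
  have := B0 (delta_mx i 0 + x *: delta_mx j 0).
  rewrite adjmxD linearZ map_mxZ /= !adjmx_delta !mulmxDl !mulmxDr.
  rewrite -!scalemxAl -!scalemxAr -!rowE -!colE !mxE.
  by rewrite mulrA [x^* * x]mulrC.
have Bii i : B i i = 0 by have := Bij i i 0; rewrite rmorph0 !mul0r !addr0.
apply/matrixP => i j; rewrite [RHS]mxE.
(* With zero diagonal, [x = 1] gives [B i j + B j i = 0] and [x = 'i] gives [B i j = B j i]. *)
have := Bij i j 1; have := Bij i j 'i.
rewrite !Bii rmorph1 conjCi !mulr0 !add0r !addr0 !mul1r.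
rewrite mulNr -mulrBr => /eqP; rewrite mulf_eq0 (negPf (neq0Ci _)) /= subr_eq0.
by move=> /eqP <- /eqP; rewrite -mulr2n mulrn_eq0 => /eqP.
Qed.

(** [sqrtmx A] is the case [f = sqrtC] by conversion. A general [f] puts the root and its
    pseudo-inverse in one commutative calculus, where identities reduce to identities between
    scalars on the eigenvalues. *)
Definition spectral_fun n (A : 'M[C]_n) (f : C -> C) : 'M[C]_n :=
  invmx (spectralmx A) *m diag_mx (map_mx f (spectral_diag A)) *m spectralmx A.

Lemma spectral_funM n (A : 'M[C]_n) f g :
  spectral_fun A f *m spectral_fun A g = spectral_fun A (fun x => f x * g x).
Proof.
rewrite /spectral_fun !mulmxA mulmxK ?spectral_unit //.
rewrite -(mulmxA _ (diag_mx _) (diag_mx _)) mulmx_diag.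
by congr (_ *m diag_mx _ *m _); apply/rowP => i; rewrite !mxE.
Qed.

Lemma spectral_fun_adj n (A : 'M[C]_n) f :
  (spectral_fun A f)^t* = spectral_fun A (fun x => (f x)^*).
Proof.
rewrite /spectral_fun !adjmxM (invmx_unitary (spectral_unitarymx A)) trmxCK.
rewrite mulmxA tr_diag_mx map_diag_mx.
by congr (_ *m diag_mx _ *m _); apply/rowP => i; rewrite !mxE.
Qed.

Lemma eq_spectral_fun n (A : 'M[C]_n) f g :
  (forall i, f (spectral_diag A 0 i) = g (spectral_diag A 0 i)) ->
  spectral_fun A f = spectral_fun A g.
Proof.
by move=> fg; congr (_ *m diag_mx _ *m _); apply/rowP => i; rewrite !mxE fg.
Qed.

Lemma psd_spectralE n (A : 'M[C]_n) : psd A -> spectral_fun A id = A.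
Proof.
move=> /psd_adj Ah; rewrite /spectral_fun map_mx_id //.
by apply/esym/orthomx_spectralP/normalmxP; rewrite Ah.
Qed.

Lemma psd_spectral_diag_ge0 n (A : 'M[C]_n) i :
  psd A -> 0 <= spectral_diag A 0 i.
Proof.
move=> A0; have Au := spectral_unitarymx A.
(* The test vector is the [i]-th eigenvector, on which the form takes the [i]-th eigenvalue. *)
have := A0 ((spectralmx A)^t* *m delta_mx i 0).
rewrite adjmxM trmxCK adjmx_delta -{2}(psd_spectralE A0) /spectral_fun.
rewrite map_mx_id // (invmx_unitary Au) !mulmxA.
rewrite -(mulmxA (delta_mx 0 i) (spectralmx A)) (unitarymxP Au) mulmx1.
rewrite -(mulmxA _ (spectralmx A) _) (unitarymxP Au) mulmx1.
by rewrite -rowE -colE !mxE eqxx mulr1n.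
Qed.

Lemma sqrtmxM n (A : 'M[C]_n) : psd A -> sqrtmx A *m sqrtmx A = A.
Proof.
move=> A0; rewrite [LHS]spectral_funM -[RHS]psd_spectralE //.
by apply: eq_spectral_fun => i; rewrite -expr2 sqrtCK.
Qed.

Lemma sqrtmx_adj n (A : 'M[C]_n) : psd A -> (sqrtmx A)^t* = sqrtmx A.
Proof.
move=> A0; rewrite [LHS]spectral_fun_adj; apply: eq_spectral_fun => i.
by apply/CrealP/ger0_real; rewrite sqrtC_ge0 psd_spectral_diag_ge0.
Qed.

Lemma psd_factor n (A : 'M[C]_n) :
  psd A -> (sqrtmx A)^t* *m sqrtmx A = A.
Proof. by move=> A0; rewrite sqrtmx_adj // sqrtmxM. Qed.

Lemma sqrtmx_pinv n (A : 'M[C]_n) : psd A -> exists T : 'M[C]_n,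
  [/\ T^t* = T, sqrtmx A *m T = T *m sqrtmx A
    & sqrtmx A *m T *m sqrtmx A = sqrtmx A].
Proof.
(* The convention [0^-1 = 0] makes this the Moore-Penrose inverse of the root: it is zero on the
   kernel of [A]. *)
move=> A0; exists (spectral_fun A (fun x => (sqrtC x)^-1)); split.
- rewrite spectral_fun_adj; apply: eq_spectral_fun => i; rewrite fmorphV.
  congr (_ ^-1).
  by apply/CrealP/ger0_real; rewrite sqrtC_ge0 psd_spectral_diag_ge0.
- rewrite [LHS]spectral_funM [RHS]spectral_funM.
  by apply: eq_spectral_fun => i; rewrite mulrC.
- rewrite [X in X *m _ = _]spectral_funM [LHS]spectral_funM.
  apply: eq_spectral_fun => i; set s := sqrtC _.
  by have [->|s0] := eqVneq s 0; rewrite ?mulr0 // divfK.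
Qed.

(** Ensemble steering, stated without the purification: an effect [Q] on the copy acts on the system
    as [Q^T] between two roots of [rho], which is why a transpose appears. *)
Lemma psd_decomp_measurement n M (rho : 'M[C]_n) (r : 'I_M -> 'M[C]_n) :
  (0 < M)%N -> psd rho -> (forall w, psd (r w)) ->
  M%:R^-1 *: (\sum_w r w) = rho ->
  exists Q : 'I_M -> 'M[C]_n,
    [/\ forall w, psd (Q w), \sum_w Q w = 1%:M
      & forall w, sqrtmx rho *m (Q w)^T *m sqrtmx rho = M%:R^-1 *: r w].
Proof.
move=> M0 rho0 r0 rE.
have M_unit : M%:R != 0 :> C by rewrite pnatr_eq0 -lt0n.
have Mi_ge0 : 0 <= M%:R^-1 :> C by rewrite invr_ge0 ler0n.
have [T [Th ST STS]] := sqrtmx_pinv rho0.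
have Sh := sqrtmx_adj rho0; have SS := sqrtmxM rho0.
move: (sqrtmx rho) ST STS Sh SS => S ST STS Sh SS.
(* [S *m T] is the projection onto the support of [rho], and [N] the one onto its kernel. *)
set N := 1%:M - S *m T.
have Nh : N^t* = N by rewrite adjmxB adjmx1 adjmxM Sh Th -ST.
have SN : S *m N = 0 by rewrite mulmxBr mulmx1 ST mulmxA STS subrr.
have NS : N *m S = 0 by rewrite mulmxBl mul1mx STS subrr.
have NN : N *m N = N by rewrite {1}/N mulmxBl mul1mx ST -mulmxA SN mulmx0 subr0.
(* [r w <= M rho], so [r w] vanishes on the kernel of [rho]. *)
have rN w : r w *m N = 0.
  suff -> : r w *m N = (sqrtmx (r w))^t* *m (sqrtmx (r w) *m N).
    rewrite (sum_adjmx_mul_eq0 (B := fun w => sqrtmx (r w) *m N)) ?mulmx0 //.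
    transitivity (N *m (\sum_w r w) *m N).
      rewrite mulmx_sumr mulmx_suml; apply: eq_bigr => w' _.
      by rewrite adjmxM Nh -{3}(psd_factor (r0 w')) !mulmxA.
    have -> : \sum_w r w = M%:R *: rho by rewrite -rE scalerA divff ?scale1r.
    by rewrite -SS -scalemxAr -scalemxAl !mulmxA NS !mul0mx scaler0.
  by rewrite mulmxA psd_factor.
have Nr w : N *m r w = 0.
  by rewrite -(psd_adj (r0 w)) -Nh -adjmxM rN trmx0 map_mx0.
have STr w : S *m T *m r w = r w.
  by have := Nr w; rewrite mulmxBl mul1mx => /eqP; rewrite subr_eq0 => /eqP.
have rTS w : r w *m (T *m S) = r w.
  have := rN w; rewrite mulmxBr mulmx1 ST => /eqP.
  by rewrite subr_eq0 => /eqP.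
(* The terms [T *m r w *m T] average to [T *m rho *m T = S *m T], and [N] completes this to the
   identity. Since [S *m N = 0], that completion disappears between the two roots. *)
exists (fun w => (M%:R^-1 *: (T *m r w *m T + N))^T); split=> [w||w].
- apply/psd_tr/psdZ => //; apply: psdD.
    by rewrite -{2}Th; apply: psd_congr.
  by rewrite -NN -{1}Nh; apply: psd_adj_mul.
- rewrite -(trmx1 C n) -linear_sum; congr (_^T).
  rewrite -scaler_sumr big_split sumr_const card_ord -mulmx_suml -mulmx_sumr /=.
  rewrite scalerDr -[N *+ M]scaler_nat scalerA mulVf // scale1r.
  rewrite scalemxAl scalemxAr rE.
  by rewrite -SS !mulmxA -ST STS addrC subrK.
- rewrite trmxK -scalemxAr -scalemxAl; congr (_ *: _).
  by rewrite mulmxDr mulmxDl SN mul0mx addr0 !mulmxA STr -mulmxA rTS.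
Qed.

End PositiveSemidefinite.

(** * Tensor products and matrix units *)

Section Tensor.
Variable R : comNzRingType.

Lemma mxtrace_tens m n (A : 'M[R]_m) (B : 'M[R]_n) :
  \tr (A *t B) = \tr A * \tr B.
Proof. by rewrite /mxtrace mulr_sum; apply: eq_bigr => i _; rewrite mxE. Qed.

Lemma sum_mxtens (V : nmodType) m n (F : 'I_(m * n) -> V) :
  \sum_r F r = \sum_i \sum_k F (mxtens_index (i, k)).
Proof.
rewrite pair_bigA /= (reindex (@mxtens_index m n)) /=.
  by apply: eq_bigr => -[].
exists (@mxtens_unindex m n) => x _;
  by rewrite (mxtens_indexK, mxtens_unindexK).
Qed.

Lemma tensmx_delta m n p q (i : 'I_m) (j : 'I_n) (k : 'I_p) (l : 'I_q) :
  delta_mx i j *t delta_mx k l =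
  delta_mx (mxtens_index (i, k)) (mxtens_index (j, l)) :> 'M[R]_(_, _).
Proof.
apply/matrixP => r s; case: (mxtens_indexP r) => i' k'.
case: (mxtens_indexP s) => j' l'; rewrite tensmxE !mxE -natrM mulnb.
by rewrite !(can_eq (@mxtens_indexK _ _)) !xpair_eqE andbACA.
Qed.

Lemma mxtrace_mul_delta n (A : 'M[R]_n) i j : \tr (A *m delta_mx i j) = A j i.
Proof.
rewrite -(mul_delta_mx (0 : 'I_1)) mulmxA mxtrace_mulC -rowE -colE.
by rewrite /mxtrace big_ord1 !mxE.
Qed.

Lemma delta_mx_sandwich m n (A : 'M[R]_m) (i j : 'I_n) (k l : 'I_m) :
  delta_mx i k *m A *m delta_mx l j = A k l *: delta_mx i j.
Proof.
(* Each unit is split into a column times a row, which leaves a 1 by 1 matrix in the middle that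
   moves out as a scalar. *)
rewrite -(mul_delta_mx (0 : 'I_1) i) -(mul_delta_mx (0 : 'I_1) l).
rewrite !mulmxA -(mulmxA _ _ A) -rowE -(mulmxA _ _ (delta_mx l 0)) -colE.
rewrite [X in _ *m X *m _]mx11_scalar !mxE mul_mx_scalar -scalemxAl.
by rewrite mul_delta_mx.
Qed.

End Tensor.

(** Turns a linearity hypothesis into a bundled map, to which [linear_sum] and [linearZ] apply. *)
Lemma linearP_ex (R : nzRingType) (U V : lmodType R) (F : U -> V) :
  linear F -> exists G : {linear U -> V}, F = G.
Proof.
move=> linF; pose m := GRing.isLinear.Build R U V _ F linF.
by exists (HB.pack_for {linear U -> V} F m).
Qed.

(** * Tensor products of maps, and measurements as operations *)

Section OperationTensor.
Variable R : realType.
Local Notation C := R[i].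

Lemma tensop_linear m n m' n' (F : 'M[C]_m -> 'M[C]_m')
  (D : 'M[C]_n -> 'M[C]_n') : linear (tensop F D).
Proof.
move=> c X Y; rewrite /tensop.
do 4!(rewrite scaler_sumr -big_split; apply: eq_bigr => ? _ /=).
by rewrite !mxE scalerDl scalerA.
Qed.

HB.instance Definition _ m n m' n' (F : 'M[C]_m -> 'M[C]_m')
    (D : 'M[C]_n -> 'M[C]_n') :=
  GRing.isLinear.Build C 'M[C]_(m * n) 'M[C]_(m' * n') _ (tensop F D)
    (tensop_linear F D).

Lemma tensop_tens m n m' n' (F : {linear 'M[C]_m -> 'M[C]_m'})
  (D : {linear 'M[C]_n -> 'M[C]_n'}) A B :
  tensop F D (A *t B) = F A *t D B.
Proof.
have tZ (p q r s : nat) (c d : C) (X : 'M[C]_(p, q)) (Y : 'M[C]_(r, s)) :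
    (c * d) *: (X *t Y) = (c *: X) *t (d *: Y).
  by apply/matrixP => i j; rewrite !mxE mulrACA.
have tl (p q r s : nat) (I : finType) (X : I -> 'M[C]_(p, q))
    (Y : 'M[C]_(r, s)) :
    (\sum_i X i) *t Y = \sum_i X i *t Y.
  apply/matrixP => i j; rewrite summxE !mxE summxE mulr_suml.
  by apply: eq_bigr => k _; rewrite !mxE.
have tr (p q r s : nat) (I : finType) (X : I -> 'M[C]_(p, q))
    (Y : 'M[C]_(r, s)) :
    Y *t (\sum_i X i) = \sum_i Y *t X i.
  apply/matrixP => i j; rewrite summxE !mxE summxE mulr_sumr.
  by apply: eq_bigr => k _; rewrite !mxE.
rewrite {2}(matrix_sum_delta A) {2}(matrix_sum_delta B) !linear_sum tl.
apply: eq_bigr => i _; rewrite linear_sum tl; apply: eq_bigr => j _.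
rewrite tr; apply: eq_bigr => k _; rewrite linear_sum tr.
by apply: eq_bigr => l _; rewrite !linearZ tensmxE -tZ.
Qed.

(** The product units span, so a linear map is fixed by its values on them. This gives closed forms
    of [tensop] for Kraus maps and for measurements. *)
Lemma tensop_unique m n m' n' (F : 'M[C]_m -> 'M[C]_m')
    (D : 'M[C]_n -> 'M[C]_n') (G : {linear 'M[C]_(m * n) -> 'M[C]_(m' * n')}) :
  (forall i j k l, G (delta_mx i j *t delta_mx k l) =
                   F (delta_mx i j) *t D (delta_mx k l)) ->
  tensop F D =1 G.
Proof.
move=> GE X; rewrite [in RHS](matrix_sum_delta X) sum_mxtens !linear_sum.
apply: eq_bigr => i _; rewrite exchange_big linear_sum /=.
apply: eq_bigr => k _; rewrite sum_mxtens linear_sum; apply: eq_bigr => j _.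
rewrite linear_sum; apply: eq_bigr => l _.
by rewrite -tensmx_delta linearZ /= GE.
Qed.

Lemma tensop_kraus d m n (I : finType) (K : I -> 'M[C]_(n, m)) X :
  tensop (@id 'M[C]_d) (fun Y => \sum_e K e *m Y *m (K e)^t*) X =
  \sum_e (1%:M *t K e) *m X *m (1%:M *t K e)^t*.
Proof.
pose G Y : 'M[C]_(d * n) := \sum_e (1%:M *t K e) *m Y *m (1%:M *t K e)^t*.
have Glin : linear G.
  move=> c Y Z; rewrite /G scaler_sumr -big_split; apply: eq_bigr => e _ /=.
  by rewrite mulmxDr mulmxDl -scalemxAr -scalemxAl.
rewrite -/(G X); have [G' GE] := linearP_ex Glin; rewrite GE.
apply: tensop_unique => i j k l; rewrite -GE /G.
apply/matrixP => r s; rewrite summxE !mxE summxE mulr_sumr.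
apply: eq_bigr => e _.
rewrite trmx_tens map_mxT adjmx1 !tensmx_mul mul1mx mulmx1.
by rewrite [LHS]mxE [X in X * _]mxE.
Qed.

Lemma kraus_completely_positive m n (I : finType) (K : I -> 'M[C]_(n, m)) :
  completely_positive (fun Y => \sum_e K e *m Y *m (K e)^t*).
Proof.
by move=> d X X0; rewrite tensop_kraus; apply: psd_sum => e; apply: psd_congr.
Qed.

(** The measurement channel of the POVM [Q]: its outcome is recorded in the classical basis of a
    [k]-dimensional system. *)
Definition povm_map n k (Q : 'I_k -> 'M[C]_n) (X : 'M[C]_n) : 'M[C]_k :=
  diag_mx (\row_w \tr (Q w *m X)).

Lemma povm_map_linear n k (Q : 'I_k -> 'M[C]_n) : linear (povm_map Q).
Proof.
move=> c X Y; rewrite /povm_map -linearP; congr diag_mx.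
by apply/rowP => w; rewrite !mxE mulmxDr -scalemxAr linearP.
Qed.

HB.instance Definition _ n k (Q : 'I_k -> 'M[C]_n) :=
  GRing.isLinear.Build C 'M[C]_n 'M[C]_k _ (povm_map Q) (povm_map_linear Q).

Lemma povm_map_operation n k (Q : 'I_k -> 'M[C]_n) :
  (forall w, psd (Q w)) -> \sum_w Q w = 1%:M -> operation (povm_map Q).
Proof.
move=> Q0 Q1; split; first exact: povm_map_linear.
(* The Kraus operators are [|w><e|] times the root of [Q w]: summing over [e] takes the trace of the
   sandwiched state and writes it at [|w><w|]. *)
- pose K (we : 'I_k * 'I_n) : 'M[C]_(k, n) :=
    delta_mx we.1 we.2 *m sqrtmx (Q we.1).
  suff -> : povm_map Q = fun Y => \sum_we K we *m Y *m (K we)^t*.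
    exact: kraus_completely_positive.
  apply/funext => Y; rewrite /povm_map diag_mx_sum_delta.
  transitivity (\sum_w \sum_e K (w, e) *m Y *m (K (w, e))^t*); last first.
    by rewrite pair_bigA; apply: eq_bigr => -[].
  apply: eq_bigr => w _; rewrite mxE -{1}(psd_factor (Q0 w)).
  rewrite -mulmxA mxtrace_mulC.
  rewrite /mxtrace scaler_suml; apply: eq_bigr => e _.
  rewrite /K /= [X in _ = _ *m X]adjmxM adjmx_delta -delta_mx_sandwich.
  by rewrite !mulmxA.
- move=> X; rewrite mxtrace_diag.
  transitivity (\tr ((\sum_w Q w) *m X)); last by rewrite Q1 mul1mx.
  by rewrite mulmx_suml linear_sum; apply: eq_bigr => w _; rewrite mxE.
Qed.

(** Measuring both sides locally is one measurement with product effects, so its output is diagonal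
    on every input, entangled ones included. *)
Lemma tensop_povm_map m n k l (Q : 'I_k -> 'M[C]_m) (P : 'I_l -> 'M[C]_n) X :
  tensop (povm_map Q) (povm_map P) X =
  povm_map (fun r => Q (mxtens_unindex r).1 *t P (mxtens_unindex r).2) X.
Proof.
apply: tensop_unique => i j p q; apply/matrixP => r s.
rewrite [RHS]mxE !mxE tensmx_mul mxtrace_tens.
case: (mxtens_indexP r) => r1 r2; case: (mxtens_indexP s) => s1 s2.
rewrite !mxtens_indexK /= (can_eq (@mxtens_indexK _ _)) xpair_eqE.
by case: eqP => _; case: eqP => _; rewrite ?mulr0n ?mulr1n ?mulr0 ?mul0r.
Qed.

Lemma local_ops_tensop m n m' n' (F : 'M[C]_m -> 'M[C]_m')
    (D : 'M[C]_n -> 'M[C]_n') :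
  operation F -> operation D -> local_ops (tensop F D).
Proof.
move=> opF opD; exists 1%N, (fun=> 1), (fun=> F), (fun=> D).
by split=> // [|X]; rewrite ?big_ord1 // scale1r.
Qed.

(** * Measuring the canonical purification *)

Lemma canonical_purificationE n (rho : 'M[C]_n) :
  canonical_purification rho =
  \sum_i \sum_j delta_mx i j *t (sqrtmx rho *m delta_mx i j *m sqrtmx rho).
Proof.
rewrite /canonical_purification /max_entangled mulmx_sumr mulmx_suml.
apply: eq_bigr => i _; rewrite mulmx_sumr mulmx_suml; apply: eq_bigr => j _.
by rewrite !tensmx_mul mul1mx mulmx1.
Qed.

Lemma ptrace2_tens m n (A : 'M[C]_m) (B : 'M[C]_n) :
  ptrace2 (A *t B) = \tr B *: A.
Proof.
apply/matrixP => i j; rewrite !mxE mulrC /mxtrace mulr_sumr.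
by apply: eq_bigr => k _; rewrite tensmxE.
Qed.

Lemma ptrace2_linear m n : linear (@ptrace2 R m n).
Proof.
move=> c X Y; apply/matrixP => i j; rewrite !mxE mulr_sumr -big_split.
by apply: eq_bigr => k _; rewrite !mxE.
Qed.

HB.instance Definition _ m n :=
  GRing.isLinear.Build C 'M[C]_(m * n) 'M[C]_m _ (@ptrace2 R m n)
    (@ptrace2_linear m n).

(** The weight of the unit [(i, j)] is [Q j i], so the units recombine to [Q^T]. This is how an
    effect on one half of the maximally entangled vector passes to the other half. *)
Lemma sum_tr_delta n (U : lmodType C) (L : {linear 'M[C]_n -> U})
    (Q : 'M[C]_n) :
  \sum_i \sum_j \tr (Q *m delta_mx i j) *: L (delta_mx i j) = L Q^T.
Proof.
rewrite [in RHS](matrix_sum_delta Q^T) linear_sum; apply: eq_bigr => i _.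
rewrite linear_sum; apply: eq_bigr => j _.
by rewrite linearZ mxE mxtrace_mul_delta.
Qed.

Lemma purification_output_trace m n (E : 'M[C]_m -> 'M[C]_n) rho Q P :
  linear E ->
  \tr ((Q *t P) *m tensop id E (canonical_purification rho)) =
  \tr (P *m E (sqrtmx rho *m Q^T *m sqrtmx rho)).
Proof.
move=> /linearP_ex [L ->]; set S := sqrtmx rho.
(* The cast to [C^o] makes the scalars a module over themselves, so that [sum_tr_delta] applies to
   this functional. *)
pose f Y := \tr (P *m L (S *m Y *m S)) : C^o.
have [f' fE] : exists f' : {linear 'M[C]_m -> C^o}, f = f'.
  apply: linearP_ex => c X Y; rewrite /f mulmxDr mulmxDl -scalemxAr -scalemxAl.
  by rewrite linearP mulmxDr -scalemxAr linearP.
rewrite -/(f Q^T) fE -sum_tr_delta -fE canonical_purificationE.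
rewrite [tensop _ _ _]linear_sum mulmx_sumr linear_sum.
apply: eq_bigr => i _ /=.
rewrite [tensop _ _ _]linear_sum mulmx_sumr linear_sum.
apply: eq_bigr => j _ /=.
by rewrite (tensop_tens idfun L) tensmx_mul mxtrace_tens.
Qed.

(** The same computation with the system traced out: this is the outcome probability on the copy
    alone. *)
Lemma purification_marginal_trace n (rho Q : 'M[C]_n) :
  \tr (Q *m ptrace2 (canonical_purification rho)) =
  \tr (sqrtmx rho *m Q^T *m sqrtmx rho).
Proof.
set S := sqrtmx rho; pose f Y := \tr (S *m Y *m S) : C^o.
have [f' fE] : exists f' : {linear 'M[C]_n -> C^o}, f = f'.
  apply: linearP_ex => c X Y; rewrite /f mulmxDr mulmxDl -scalemxAr -scalemxAl.
  by rewrite linearP.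
rewrite -/(f Q^T) fE -sum_tr_delta -fE canonical_purificationE.
rewrite [ptrace2 _]linear_sum mulmx_sumr linear_sum; apply: eq_bigr => i _ /=.
rewrite [ptrace2 _]linear_sum mulmx_sumr linear_sum; apply: eq_bigr => j _ /=.
by rewrite ptrace2_tens -scalemxAr linearZ /= mulrC.
Qed.

End OperationTensor.

(** * From a code to a test, and from the test to the bounds *)

Section Converse.
Variable R : realType.
Local Notation C := R[i].

Lemma Re_invn_mul M (z : C) :
  complex.Re (M%:R^-1 * z) = M%:R^-1 * complex.Re z.
Proof.
have -> : M%:R^-1 = (M%:R^-1)%:C :> C by rewrite fmorphV rmorph_nat.
by case: z => x y; rewrite /= mul0r subr0.
Qed.

Lemma sum_diag_test M (f : 'I_M -> 'I_M -> R) :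
  \sum_(r < M * M) f (mxtens_unindex r).1 (mxtens_unindex r).2 *
    ((mxtens_unindex r).1 == (mxtens_unindex r).2)%:R = \sum_w f w w.
Proof.
rewrite sum_mxtens; apply: eq_bigr => w _.
under eq_bigr do rewrite mxtens_indexK.
rewrite (bigD1 w) //= eqxx mulr1 big1 ?addr0 // => w' /negPf ww'.
by rewrite eq_sym ww' mulr0.
Qed.

Lemma beta_le_test (eps : R) (I : finType) (P0 P1 T : I -> R) :
  (forall r, 0 <= T r <= 1) -> 1 - eps <= \sum_r P0 r * T r ->
  (beta eps P0 P1 <= (\sum_r P1 r * T r)%:E)%E.
Proof. by move=> T01 T0; apply: ereal_inf_lbound; exists T. Qed.

Lemma sum_code_prob M a b (c : unassisted_code R M a b)
    (E : 'M[C]_a -> 'M[C]_b) w :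
  trace_preserving E -> \sum_w' code_prob c E w w' = 1.
Proof.
move=> tpE; rewrite /code_prob -(raddf_sum (@complex.Re R)) -linear_sum /=.
by rewrite -mulmx_suml decoding_sum mul1mx tpE (encoding_state c w).2.
Qed.

(** For each message the outcome probabilities sum to 1, so success and error add up to 1 on
    average. *)
Lemma success_prob M a b (c : unassisted_code R M a b)
    (E : 'M[C]_a -> 'M[C]_b) :
  (0 < M)%N -> trace_preserving E ->
  M%:R^-1 * \sum_w code_prob c E w w = 1 - error_prob c E.
Proof.
move=> M0 tpE; apply/eqP; rewrite eq_sym subr_eq eq_sym; apply/eqP.
rewrite /error_prob -mulrDr -big_split /=.
transitivity (M%:R^-1 * \sum_(w < M) 1 : R).
  congr (_ * _); apply: eq_bigr => w _.
  by rewrite -(sum_code_prob c w tpE) [RHS](bigD1 w).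
by rewrite sumr_const card_ord mulVf // pnatr_eq0 -lt0n.
Qed.

(** The measurement and the test are built from the code alone, so one bound serves every [sigma]
    and survives the minimum over them. *)
Lemma code_beta_class M a b (E : 'M[C]_a -> 'M[C]_b) (eps : R)
    (Omega : bipartite_class R) rho sigma (c : unassisted_code R M a b) :
  operation E -> contains_local Omega -> states rho -> states sigma ->
  is_code eps rho E c ->
  (beta_class Omega eps
     (tensop (@id 'M[C]_a) E (canonical_purification rho))
     (ptrace2 (canonical_purification rho) *t sigma) <= (M%:R^-1)%:E)%E.
Proof.
move=> [linE _ tpE] locO [rho0 _] [_ sigma1] [M0 err rhoE].
have [Q [Q0 Q1 QE]] :=
  psd_decomp_measurement M0 rho0 (fun w => (encoding_state c w).1) rhoE.
pose P := decoding c.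
pose G := tensop (povm_map Q) (povm_map P).
have opG : mops Omega G.
  split.
    apply/locO/local_ops_tensop; apply: povm_map_operation => //.
      exact: decoding_psd.
    exact: decoding_sum.
  by move=> tau _; rewrite /G tensop_povm_map diag_mx_is_diag.
have GE tau r : diag_distr (G tau) r = complex.Re (\tr
    ((Q (mxtens_unindex r).1 *t P (mxtens_unindex r).2) *m tau)).
  by rewrite /diag_distr /G tensop_povm_map !mxE eqxx mulr1n.
pose T (r : 'I_(M * M)) : R :=
  ((mxtens_unindex r).1 == (mxtens_unindex r).2)%:R.
have TE tau : \sum_r diag_distr (G tau) r * T r =
    \sum_w complex.Re (\tr ((Q w *t P w) *m tau)).
  under eq_bigr do rewrite GE.
  exact: (sum_diag_test (fun w w' => complex.Re (\tr ((Q w *t P w') *m tau)))).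
apply: (@le_trans _ _ (beta eps
  (diag_distr (G (tensop id E (canonical_purification rho))))
  (diag_distr (G (ptrace2 (canonical_purification rho) *t sigma))))).
  by apply: ereal_inf_lbound; exists M, M, G.
apply: le_trans (@beta_le_test _ _ _ _ T _ _) _.
- by move=> r; rewrite /T; case: (_ == _); rewrite lexx ler01.
(* By steering, outcome [w] on the copy sends [M^-1] times codeword [w] through [E], so agreement
   has the success probability of the code. *)
- rewrite TE; apply: le_trans (_ : 1 - error_prob c E <= _).
    by rewrite lerB.
  rewrite -success_prob // mulr_sumr ler_sum // => w _.
  rewrite purification_output_trace // QE.
  have [L LE] := linearP_ex linE.
  by rewrite LE linearZ -scalemxAr linearZ /= -LE Re_invn_mul.
(* On the product state each outcome on the copy has probability [M^-1]; what remains is the sum of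
   the decoding probabilities on [sigma], which is 1. *)
- rewrite lee_fin TE.
  under eq_bigr => w _.
    rewrite tensmx_mul mxtrace_tens purification_marginal_trace QE linearZ /=.
    rewrite (encoding_state c w).2 mulr1 Re_invn_mul.
    over.
  rewrite -mulr_sumr -(raddf_sum (@complex.Re R)) -linear_sum /=.
  by rewrite -mulmx_suml decoding_sum mul1mx sigma1 mulr1.
Qed.

(** [lne] is [-oo] on all nonpositive arguments, so its monotonicity extends to the whole extended
    line. *)
Lemma le_lne (x y : \bar R) : (x <= y -> lne x <= lne y)%E.
Proof.
move=> xy; have [x0|x0] := leP x 0%E; first by rewrite le0_lneNy ?leNye.
by rewrite lee_lne // in_itv /= ?leey ?andbT ?(ltW x0) ?(le_trans (ltW x0)).
Qed.

(** Writing [y] as [lne (expeR y)] reduces the claim to an upper bound on the elements of [S]. This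
    also covers an empty set of code sizes and an infinite supremum. *)
Lemma lne_ereal_sup_le (S : set (\bar R)) y :
  (forall x, S x -> (lne x <= y)%E) -> (lne (ereal_sup S) <= y)%E.
Proof.
move=> Sy; rewrite -[leRHS]expeRK; apply/le_lne/ge_ereal_sup => x Sx.
have [x0|x0] := leP x 0%E; first by rewrite (le_trans x0) ?expeR_ge0.
by rewrite -[leLHS]lneK ?lee_expeR ?Sy // in_itv /= leey ltW.
Qed.

Lemma code_size_le_I_class M a b (E : 'M[C]_a -> 'M[C]_b) (eps : R)
    (Omega : bipartite_class R) rho (c : unassisted_code R M a b) :
  operation E -> contains_local Omega -> states rho -> is_code eps rho E c ->
  (lne (M%:R)%:E <= I_class Omega eps E rho)%E.
Proof.
move=> opE locO rhoS codec; apply/ereal_infP => _ [sigma sigmaS <-].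
have M0 : 0 < M%:R :> R by case: codec => M0 _ _; rewrite ltr0n.
(* Moving the sign across turns the goal into [lne] of [beta_class] being at most [lne] of
   [M^-1]. *)
rewrite /D_class leeNr -lneV //; apply: le_lne.
exact: code_beta_class codec.
Qed.

End Converse.

Theorem theorem19 (R : realType) (a b : nat) (E : 'M[R[i]]_a -> 'M[R[i]]_b)
    (eps : R) (Omega : bipartite_class R) :
  operation E -> 0 <= eps <= 1 -> contains_local Omega ->
  (forall rho : 'M[R[i]]_a, states rho ->
     (lne (max_size_at eps E rho) <= I_class Omega eps E rho)%E) /\
  (lne (max_size eps E) <=
     ereal_sup [set I_class Omega eps E rho | rho in @states R a])%E.
Proof.
move=> opE _ locO; split=> [rho rhoS|].
  apply: lne_ereal_sup_le => _ [M [c codec] <-].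
  exact: code_size_le_I_class codec.
apply: lne_ereal_sup_le => _ [M [rho [c [rhoS codec]]] <-].
apply: le_trans (code_size_le_I_class opE locO rhoS codec) _.
by apply: ereal_sup_ubound; exists rho.
Qed.
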